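(* Let $\mathcal{I}$ be a proper admissible ideal on $\mathbb{N}$. A compact Hausdorff space $X$ is $\mathcal{I}$-H-separable if and only if its $\pi$-weight is countable, i.e. $\pi w(X) \leq \omega$.
   Context: An ideal on $\mathbb{N}$ is a family of subsets of $\mathbb{N}$ closed under finite unions and under subsets; it is admissible if it contains every singleton and proper if it does not contain $\mathbb{N}$. A space $X$ is $\mathcal{I}$-H-separable if for every sequence $(Y_n)_{n\in\mathbb{N}}$ of dense subspaces of $X$ there is a sequence $(F_n)_{n\in\mathbb{N}}$ such that each $F_n$ is a finite subset of $Y_n$ and for every nonempty open set $U$ of $X$, $\{n\in\mathbb{N} : U\cap F_n=\emptyset\}\in\mathcal{I}$. A $\pi$-base of a space is a collection $\mathcal{B}$ of open sets such that every nonempty open set contains a nonempty member of $\mathcal{B}$; the $\pi$-weight $\pi w(X)$ is the least cardinality of a $\pi$-base of $X$. *)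

(* Defs.v *)
From mathcomp Require Import all_boot.
From mathcomp Require Import boolp classical_sets functions cardinality.
From mathcomp Require Import topology.

Set Implicit Arguments.
Unset Strict Implicit.
Unset Printing Implicit Defensive.

Local Open Scope classical_set_scope.
Local Open Scope card_scope.

(* [set0] is the union of the empty finite family. *)
Definition set_ideal (I : set_system nat) : Prop :=
  [/\ I set0,
      forall A B, I A -> I B -> I (A `|` B)
    & forall A B, A `<=` B -> I B -> I A].

Definition admissible_set_ideal (I : set_system nat) : Prop := forall n, I [set n].

Definition proper_set_ideal (I : set_system nat) : Prop := ~ I [set: nat].

Definition H_separable (I : set_system nat) (X : topologicalType) : Prop :=
  forall Y : nat -> set X, (forall n, dense (Y n)) ->
  exists F : nat -> set X,
    (forall n, finite_set (F n) /\ F n `<=` Y n) /\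
    (forall U : set X, open U -> U !=set0 ->
       I [set n | U `&` F n = set0]).

Definition pi_base (X : topologicalType) (B : set_system X) : Prop :=
  (forall V, B V -> open V) /\
  (forall U : set X, open U -> U !=set0 ->
     exists V, [/\ B V, V !=set0 & V `<=` U]).

Definition least_pi_base (X : topologicalType) (B : set_system X) : Prop :=
  pi_base B /\ forall B' : set_system X, pi_base B' -> B #<= B'.

(* pi w(X) is represented by a pi-base of least cardinality: cardinals are
   not objects in the library, only compared through sets by [#<=]. *)
Definition pi_weight_le (X : topologicalType) (T : Type) (K : set T) : Prop :=
  exists B : set_system X, least_pi_base B /\ B #<= K.
Arguments pi_weight_le X {T} K.

(* Main.v *)
Require Import Defs.
From mathcomp Require Import all_boot.
From mathcomp Require Import boolp classical_sets functions cardinality.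
From mathcomp Require Import wochoice.
From mathcomp Require Import topology.
Local Open Scope classical_set_scope.

Set Implicit Arguments.
Unset Strict Implicit.
Unset Printing Implicit Defensive.

(** From a countable pi-base one picks, at stage [n], one point of [Y n] in
each of its first [n + 1] members; a nonempty open set then misses only
finitely many stages.

The converse uses only that, the ideal being proper, every dense set contains
a countable dense set ([H_separable_dense]). Compare nonempty open sets by
[U <= V] when [U] lies in the closure of [V]; by regularity it is enough to
find a countable family which is coinitial for this preorder
([coinitial_pi_base]). Suppose that there is none. The plan is to build a dense
set [Y] such that each countable subset of [Y] misses some nonempty open set.

Let [O_a], for [a] in a well-ordered set, be nonempty open sets. For a nonempty
open set [U], say that [a] is evaded by [U] if no nonempty set obtained from
[U] by removing the closures of finitely many [O_b] with [b < a] lies in the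
closure of [O_a]. If all indices of a finite set are evaded by [U], removing
the corresponding closures from [U] one after the other, in increasing order,
never exhausts [U]; by compactness some point in the closure of [U] lies in no
[O_a] with [a] evaded by [U] ([avoid_evaded]). Let [Y] consist of one such
point for each [U]. A countable subset of [Y] involves countably many [U], and
it misses [O_a] as soon as [a] is evaded by all of them. So it suffices that
any countably many nonempty open sets simultaneously evade some index.

Such a family [O] exists in any preorder without a countable coinitial family
([evading_family]). Call an index set small if all families indexed by it have
a countable lower bound, in the sense that each member lies above one of
countably many elements. Small sets are closed under countable unions,
products and finite sequences, so in a well-order one can take a minimal
non-small initial segment, all of whose proper initial segments are small, with
no computation of cardinals. Take a family [F] on it without countable lower
bound. Let [O_a] be chosen from a sequence [c a 0, c a 1, ...]. If every such
system [c] fails, countably many open sets [Phi c] witness the failure: each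
[c a i] lies above a set obtained from a member of [Phi c] by removing finitely
many closures of indices below [a]. Start with [c a i = F a] and let the next
system list, at [a], a countable lower bound of all sets obtained from the
current witnesses by removing finitely many closures of indices at most [a];
smallness of the segment below [a] provides it. After countably many steps,
each remainder of a witness lies above a member of the next system with the
same last index, which lies above a remainder with only smaller indices, and so
on; well-foundedness ends this descent at a witness. The witnesses of all steps
are then a countable lower bound of [F], a contradiction. Finally, some fixed
position [i] in the sequences works for all countable families at once: if
each position failed for some family, the union of these countably many
families would fail for all positions. *)

(** * Well-orders and finite sequences *)

Definition strict_well_order T (lt : T -> T -> Prop) : Prop :=
  [/\ well_founded lt,
      forall y x z, lt x y -> lt y z -> lt x z
    & forall x y, [\/ lt x y, x = y | lt y x]].

Lemma strict_well_order_exists (T : Type) :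
  exists lt : T -> T -> Prop, strict_well_order lt.
Proof.
have [R Rwo] := well_ordering_principle {classic T}.
have Rmin (A : set T) a : A a -> exists2 m, A m & forall x, A x -> R m x.
  move=> Aa; have [|m [[/asboolP mA mlb] _]] := Rwo [pred x | `[< A x >]].
    by exists a; exact/asboolP.
  by exists m => // x Ax; apply: mlb; exact/asboolP.
have Rwo_chain : wo_chain R predT by move=> A _; apply: Rwo.
have Rtot x y : R x y || R y x by exact: (wo_chainW Rwo_chain).
have Ranti x y : R x y -> R y x -> x = y.
  by move=> xy yx; apply: (wo_chain_antisymmetric Rwo_chain) => //; rewrite xy.
exists (fun x y => ~ R y x); split=> [|y x z nyx nzy zx|x y].
- suff : ~ exists x, ~ Acc (fun x y => ~ R y x) x.
    by move=> noex x; apply: contrapT => nx; apply: noex; exists x.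
  case=> x; move=> /(Rmin (fun x => ~ Acc _ x))[m nm mmin]; apply: nm.
  by constructor=> z; apply: contra_notP; exact: mmin.
- have [m mE mmin] := Rmin [set t | [\/ t = x, t = y | t = z]] x (Or31 _ _ erefl).
  case: mE => mE; rewrite mE in mmin.
  + have xz := Ranti _ _ zx (mmin z (Or33 _ _ erefl)); rewrite xz in nzy.
    by have /orP[] := Rtot x y.
  + by apply: nyx; apply: mmin; constructor 1.
  + by apply: nzy; apply: mmin; constructor 2.
- have [xy|nxy] := pselect (R x y); have [yx|nyx] := pselect (R y x).
  + by constructor 2; apply: Ranti.
  + by constructor 1.
  + by constructor 3.
  + by have /orP[] := Rtot x y.
Qed.

Definition below T (lt : T -> T -> Prop) (a : T) : set T := [set b | lt b a].

Definition lists_in T (A : set T) : set (seq T) := [set s | all (mem A) s].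

Lemma sub_lists_in T (A B : set T) s : A `<=` B -> lists_in A s -> lists_in B s.
Proof. by move=> AB; apply: sub_all => x /set_mem/AB/mem_set. Qed.

Lemma lists_inI T (A B : set T) s :
  lists_in (A `&` B) s <-> lists_in A s /\ lists_in B s.
Proof.
split=> [ABs|[As Bs]].
  by split; apply: sub_lists_in ABs => x [].
rewrite /lists_in /=; elim: s As Bs => //= x s IHs /andP[/set_mem Ax As].
move=> /andP[/set_mem Bx Bs]; apply/andP; split; last exact: IHs.
exact/mem_set.
Qed.

Lemma lists_in_filter T (A B : set T) s :
  lists_in A s -> lists_in (A `&` B) [seq x <- s | x \in B].
Proof.
rewrite /lists_in /=; elim: s => //= x s IHs /andP[/set_mem Ax /IHs As].
by case: ifP => //= /set_mem Bx; apply/andP; split=> //; exact/mem_set.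
Qed.

(** A nonempty finite sequence has a last element for the well-order; it is
stated as an upper bound that shares the property [A] of all the entries. *)
Lemma exists_last T (lt : T -> T -> Prop) (A : set T) (s : seq T) :
  strict_well_order lt -> lists_in A s -> s <> [::] ->
  exists2 m, A m & lists_in (below lt m `|` [set m]) s.
Proof.
move=> [_ tr tot]; elim: s => // t s IHs /andP[/set_mem At As] _.
case: s IHs As => [_ _|t' s IHs As].
  by exists t => //; rewrite /lists_in /= andbT; apply/mem_set; right.
have [//|m Am sm] := IHs As.
have [tm|tm|mt] := tot t m.
- by exists m => //; apply/andP; split=> //; apply/mem_set; left.
- by exists m => //; apply/andP; split=> //; apply/mem_set; right.
- exists t => //; apply/andP; split; first by apply/mem_set; right.
  apply: sub_all sm => x /set_mem xm; apply/mem_set; left.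
  by case: xm => [xm|->] //; exact: tr xm mt.
Qed.

(** * Index sets whose families have countable lower bounds *)

Section Minorized.
Variables (P : Type) (le : P -> P -> Prop) (p0 : P).
Hypothesis le_refl : forall p, le p p.
Hypothesis le_trans : forall q p r, le p q -> le q r -> le p r.

(** Smallness is a substitute for having cardinality less than the least size of
a family without countable lower bound: it has the closure properties needed
here without any cardinal arithmetic. *)
Definition small T (A : set T) : Prop :=
  forall F : T -> P, exists D : nat -> P, forall t, A t -> exists n, le (D n) (F t).

Lemma sub_small T (A B : set T) : A `<=` B -> small B -> small A.
Proof. by move=> AB sB F; have [D DP] := sB F; exists D => t /AB/DP. Qed.

Lemma small_image T T' (f : T -> T') (A : set T) : small A -> small (f @` A).
Proof.
by move=> sA F; have [D DP] := sA (F \o f); exists D => _ [t /DP + <-].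
Qed.

Lemma merge_sequences (E : nat -> nat -> P) :
  exists D : nat -> P, forall i j, exists n, D n = E i j.
Proof.
exists (fun n => if unpickle n is Some (i, j) then E i j else p0) => i j.
by exists (pickle (i, j)); rewrite pickleK.
Qed.

Lemma small_bigcup T (A : nat -> set T) :
  (forall n, small (A n)) -> small (\bigcup_n A n).
Proof.
move=> sA F; have [E EP] := choice (fun n => sA n F).
have [D DE] := merge_sequences E; exists D => t [n _ /EP[j Fj]].
by have [k Dk] := DE n j; exists k; rewrite Dk.
Qed.

(** Bound each section [F (t, _)] by a sequence, then bound, for each [i], the
family of the [i]-th terms. *)
Lemma small_setX T T' (A : set T) (B : set T') :
  small A -> small B -> small (A `*` B).
Proof.
move=> sA sB F.
have [E EP] := choice (fun t => sB (fun t' => F (t, t'))).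
have [G GP] := choice (fun i => sA (fun t => E t i)).
have [D DG] := merge_sequences G; exists D => -[t t'] /= [At /(EP t)[i Ei]].
have [j Gj] := GP i t At; have [k Dk] := DG i j; exists k.
by rewrite Dk; apply: le_trans Ei.
Qed.

Lemma small_nat (A : set nat) : small A.
Proof. by move=> F; exists F => n _; exists n. Qed.

Lemma small_set1 T (t : T) : small [set t].
Proof. by move=> F; exists (fun=> F t) => _ ->; exists 0. Qed.

Lemma small_setU T (A B : set T) : small A -> small B -> small (A `|` B).
Proof.
by move=> sA sB; rewrite -bigcup2E; apply: small_bigcup => -[|[|n]] //=;
  apply: sub_small sA.
Qed.

Lemma small_lists T (A : set T) : small A -> small (lists_in A).
Proof.
move=> sA; suff sAn n : small [set s | lists_in A s /\ size s = n].
  apply: sub_small (small_bigcup sAn) => s As.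
  by exists (size s).
elim: n => [|n IHn].
  by apply: sub_small (small_set1 [::]) => s [_ /size0nil].
apply: sub_small (small_image (fun ts => ts.1 :: ts.2) (small_setX sA IHn)).
by case=> [[]//|t s] [/andP[/set_mem At As] [sn]]; exists (t, s).
Qed.

(** * Families evading every countable set *)

Lemma minimal_nonsmall : ~ small [set: P] ->
  exists (lt : P -> P -> Prop) (A : set P),
    [/\ strict_well_order lt, ~ small A
      & forall a, A a -> small (below lt a) /\ below lt a `<=` A].
Proof.
move=> nsP; have [lt swo] := strict_well_order_exists P.
have [wf tr _] := swo.
have [[a0 na0]|nsmall] := pselect (exists a, ~ small (below lt a)); last first.
  exists lt, setT; split=> // a _; split=> //.
  by apply: contrapT => na; apply: nsmall; exists a.
elim/(well_founded_ind wf): a0 na0 => a IHa na.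
have [[b ba nb]|nb] := pselect (exists2 b, lt b a & ~ small (below lt b)).
  exact: IHa nb.
exists lt, (below lt a); split=> // b ba; split=> [|c cb]; last exact: tr cb ba.
by apply: contrapT => nsb; apply: nb; exists b.
Qed.

(* In the application [w p s] is what remains of the open set [p] after removal
   of the closures of the entries of [s]; the argument works for any [w]. *)
Variable (w : P -> seq P -> P).
Hypothesis w_nil : forall p, le p (w p [::]).

Definition choices (c : P -> nat -> P) (e : seq (P * nat)) : seq P :=
  [seq c ai.1 ai.2 | ai <- e].

Definition coded_below (lt : P -> P -> Prop) (a : P) : set (seq (P * nat)) :=
  lists_in (below lt a `*` setT).

(** A countable family cannot defeat every system of candidates. Otherwise let
[Phi c] defeat [c], and let [Psi c] enumerate at each index [a] lower bounds
for what [Phi c] leaves after removal of candidates of index at most [a]. Along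
the iterates of [Psi], the last index in a remainder can be decreased at the
cost of one iteration, until nothing is removed. *)
Lemma evading_sequences (lt : P -> P -> Prop) (A : set P) :
  strict_well_order lt -> ~ small A ->
  (forall a, A a -> small (below lt a) /\ below lt a `<=` A) ->
  exists c : P -> nat -> P, forall h : nat -> P, exists a i, A a /\
    forall k e, coded_below lt a e -> ~ le (w (h k) (choices c e)) (c a i).
Proof.
move=> swo nsA belowA; apply: contrapT => noc; apply: nsA => F.
have [wf tr tot] := swo.
have /choice[Phi PhiP] (c : P -> nat -> P) : exists h : nat -> P,
    forall a i, A a -> exists k e, coded_below lt a e /\
      le (w (h k) (choices c e)) (c a i).
  apply: contrapT => noh; apply: noc; exists c => h.
  apply: contrapT => noai; apply: noh; exists h => a i Aa.
  apply: contrapT => noke; apply: noai; exists a, i; split=> // k e ea lea.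
  by apply: noke; exists k, e.
have /choice[Psi PsiP] (c : P -> nat -> P) : exists c' : P -> nat -> P,
    forall a, A a -> forall k e, lists_in ((below lt a `|` [set a]) `*` setT) e ->
      exists i, le (c' a i) (w (Phi c k) (choices c e)).
  have /choice[c' c'P] (a : P) : exists D : nat -> P, A a ->
      forall k e, lists_in ((below lt a `|` [set a]) `*` setT) e ->
      exists i, le (D i) (w (Phi c k) (choices c e)).
    have [Aa|nAa] := pselect (A a); last by exists (fun=> p0).
    have sa : small (lists_in ((below lt a `|` [set a]) `*` [set: nat])).
      apply/small_lists/small_setX; last exact: small_nat.
      apply: small_setU; last exact: small_set1.
      by case: (belowA a Aa).
    have [D DP] := small_setX (small_nat setT) sa
      (fun ke => w (Phi c ke.1) (choices c ke.2)).
    by exists D => _ k e ea; apply: (DP (k, e)).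
  by exists c'.
pose cs n := iter n Psi (fun a _ => F a).
(* The step [n] is not fixed in the induction: decreasing the index [a] goes
   from the [n]-th system to the next one. *)
have minor a : A a -> forall n k e, coded_below lt a e ->
    exists m l, le (Phi (cs m) l) (w (Phi (cs n) k) (choices (cs n) e)).
  elim/(well_founded_ind wf): a => a IHa Aa n k e ea.
  have [->|en0] := pselect (e = [::]); first by exists n, k; exact: w_nil.
  have [||b ba eb] := @exists_last _ lt (below lt a) (unzip1 e) swo.
  - rewrite /lists_in /= all_map; apply: sub_all ea => -[x i] /set_mem[/= xa _].
    exact/mem_set.
  - by case: (e) en0.
  have Ab : A b by have [_] := belowA a Aa; apply.
  have [|i ci] := PsiP (cs n) b Ab k e.
    move: eb; rewrite /lists_in /= all_map; apply: sub_all => -[x i] /set_mem xb.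
    exact/mem_set.
  have [k' [e' [e'b le']]] := PhiP (cs n.+1) b i Ab.
  have [m [l lem]] := IHa b ba Ab n.+1 k' e' e'b.
  by exists m, l; apply: le_trans lem _; apply: le_trans le' _.
have [D DP] := merge_sequences (fun m l => Phi (cs m) l); exists D => a Aa.
have [k [e [ea lea]]] := PhiP (cs 0) a 0 Aa.
have [m [l lem]] := minor a Aa 0 k e ea.
by have [n Dn] := DP m l; exists n; rewrite Dn; apply: le_trans lem lea.
Qed.

(** One candidate per index is enough: if for each position [i] some countable
family defeated the candidates in position [i], the union of these families
would defeat all positions. *)
Lemma evading_family : ~ small [set: P] ->
  exists (lt : P -> P -> Prop) (A : set P) (c : P -> P),
    strict_well_order lt /\
    forall h : nat -> P, exists2 a, A a &
      forall k s, lists_in (below lt a) s -> ~ le (w (h k) (map c s)) (c a).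
Proof.
move=> /minimal_nonsmall[lt [A [swo nsA belowA]]].
have [c cP] := evading_sequences swo nsA belowA.
suff [i iP] : exists i, forall h : nat -> P, exists2 a, A a &
    forall k s, lists_in (below lt a) s ->
      ~ le (w (h k) [seq c b i | b <- s]) (c a i).
  by exists lt, A, (c^~ i).
apply: contrapT => noi.
have /choice[H HP] i : exists h : nat -> P, forall a, A a -> exists k s,
    lists_in (below lt a) s /\ le (w (h k) [seq c b i | b <- s]) (c a i).
  apply: contrapT => noh; apply: noi; exists i => h.
  apply: contrapT => noa; apply: noh; exists h => a Aa.
  apply: contrapT => noks; apply: noa; exists a => // k s sa les.
  by apply: noks; exists k, s.
have [h hP] := merge_sequences H.
have [a [i [Aa ai]]] := cP h; have [k [s [sa les]]] := HP i a Aa.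
have [n hn] := hP i k.
apply: (ai n [seq (b, i) | b <- s]); last by rewrite hn /choices -map_comp.
rewrite /coded_below /lists_in /= all_map; apply: sub_all sa => b /set_mem ba.
exact/mem_set.
Qed.

End Minorized.

(** * Remainders of open sets *)

(** Cluster points of the filter generated by the sets of points of [K] avoiding
finitely many [O i] avoid all of them. *)
Lemma compact_avoid (X : topologicalType) I (K : set X) (A : set I) (O : I -> set X) :
  compact K -> (forall i, A i -> open (O i)) ->
  (forall s, lists_in A s -> exists2 x, K x & all (fun i => x \notin O i) s) ->
  exists2 x, K x & forall i, A i -> ~ O i x.
Proof.
move=> cK oO fip.
pose Avoid s := K `&` [set x | all (fun i => x \notin O i) s].
pose F := filter_from (lists_in A) Avoid.
have FF : ProperFilter F.
  apply: filter_from_proper; last by move=> s /fip[x Kx xs]; exists x.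
  apply: filter_from_filter; first by exists [::].
  move=> s t As At; exists (s ++ t); first by apply/(@idP (all _ _)); rewrite all_cat; apply/andP.
  by move=> x [Kx] /=; rewrite all_cat => /andP[].
have FK : F K by exists [::] => // x [].
have [x [Kx Fx]] := cK F FF FK; exists x => // i Ai Oix.
have [||z [[_ /= zi] Oiz]] := Fx (Avoid [:: i]) (O i).
- by exists [:: i] => //; rewrite /lists_in /= andbT; exact/mem_set.
- by apply: open_nbhs_nbhs; split=> //; exact: oO.
- by move: zi; rewrite andbT notin_setE.
Qed.

Section NonemptyOpens.
Variable X : topologicalType.

Definition nopen := {U : set X | open U /\ U !=set0}.

(** Inclusion in the closure, rather than inclusion, makes a failure of
[refines U V] leave the nonempty open set [U `\` closure V]. *)
Definition refines (U V : nopen) : Prop := sval U `<=` closure (sval V).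

Lemma refines_refl U : refines U U.
Proof. exact: subset_closure. Qed.

Lemma refines_trans V U W : refines U V -> refines V W -> refines U W.
Proof.
by move=> UV VW; apply: subset_trans UV _; rewrite closureE; apply: smallest_sub;
  [exact: closed_closure|].
Qed.

Definition remove_closures (U : set X) (s : seq nopen) : set X :=
  foldr (fun V W => W `\` closure (sval V)) U s.

Lemma open_remove_closures U s : open U -> open (remove_closures U s).
Proof.
move=> oU; elim: s => //= V s IHs; rewrite setDE; apply: openI => //.
by apply: closed_openC; exact: closed_closure.
Qed.

Lemma remove_closuresP U s x : remove_closures U s x <->
  U x /\ all (fun V => x \notin closure (sval V)) s.
Proof.
elim: s => [|V s IHs] /=; first by split=> [|[]].
split=> [[/IHs[Ux xs] xV]|[Ux /andP[xV xs]]].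
  by split=> //; apply/andP; split=> //; rewrite notin_setE.
by split; [exact/IHs|rewrite notin_setE in xV].
Qed.

(** The value is [U] itself when nothing is left of [U], so that it is always
a nonempty open set. *)
Definition remainder (U : nopen) (s : seq nopen) : nopen :=
  if pselect (remove_closures (sval U) s !=set0) is left ne
  then exist _ _ (conj (open_remove_closures s (proj1 (svalP U))) ne) else U.

Lemma remainder_nil U : refines U (remainder U [::]).
Proof.
by rewrite /remainder; case: pselect => [?|_]; exact: subset_closure.
Qed.

Lemma sval_remainder U s : remove_closures (sval U) s !=set0 ->
  sval (remainder U s) = remove_closures (sval U) s.
Proof. by rewrite /remainder; case: pselect. Qed.

End NonemptyOpens.

(** * Countable pi-bases of compact Hausdorff spaces *)

Section CompactHausdorff.
Variable X : topologicalType.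
Hypotheses (X_compact : compact [set: X]) (X_hausdorff : hausdorff_space X).

Lemma shrink_nopen (U : nopen X) : exists V : nopen X, closure (sval V) `<=` sval U.
Proof.
case: U => U [oU [x Ux]] /=.
have nU : nbhs x U by exact: open_nbhs_nbhs.
have [V nV VU] := @compact_regular _ x setT X_hausdorff X_compact filterT U nU.
exists (exist _ V° (conj (@open_interior _ V) (ex_intro _ x nV))) => /=.
exact: subset_trans (closureS (@interior_subset _ V)) VU.
Qed.

Lemma coinitial_pi_base (D : nat -> nopen X) :
  (forall U, exists n, refines (D n) U) -> pi_base (range (fun n => sval (D n))).
Proof.
move=> DP; split=> [_ [n _ <-]|U oU U0]; first by case: (svalP (D n)).
have [V VU] := shrink_nopen (exist _ U (conj oU U0)).
have [n nV] := DP V; exists (sval (D n)); split.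
- by exists n.
- by case: (svalP (D n)).
- exact: subset_trans nV VU.
Qed.

Section AvoidingPoints.
Variables (lt : nopen X -> nopen X -> Prop) (A : set (nopen X)).
Variable c : nopen X -> nopen X.
Hypothesis lt_swo : strict_well_order lt.

Definition evaded_at (U : nopen X) : set (nopen X) :=
  [set a | A a /\ forall s, lists_in (below lt a) s ->
     ~ refines (remainder U (map c s)) (c a)].

(** By induction on the last index [m] of [s]: what is left after the removal of
the smaller indices is not inside the closure of [c m]. *)
Lemma remove_evaded_neq0 U s : lists_in (evaded_at U) s ->
  remove_closures (sval U) (map c s) !=set0.
Proof.
have [wf _ _] := lt_swo.
suff last_case m : evaded_at U m -> forall t,
    lists_in (evaded_at U) t -> lists_in (below lt m `|` [set m]) t ->
    remove_closures (sval U) (map c t) !=set0.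
  have [->|s0 Es] := pselect (s = [::]); first by case: (svalP U).
  have [m Em sm] := exists_last lt_swo Es s0.
  exact: (last_case m Em).
elim/(well_founded_ind wf): m => m IHm Em t Et tm.
pose t' := [seq a <- t | a \in below lt m].
have Et' : lists_in (evaded_at U `&` below lt m) t' by exact: lists_in_filter.
have [Et'1 mt'] := (lists_inI _ _ _).1 Et'.
have t'0 : remove_closures (sval U) (map c t') !=set0.
  have [->|t'n] := pselect (t' = [::]); first by case: (svalP U).
  have [a [Ea am] t'a] := exists_last lt_swo Et' t'n.
  exact: (IHm a am Ea).
have [x [/remove_closuresP[Ux xt'] xm]] :
    exists x, remove_closures (sval U) (map c t') x /\ ~ closure (sval (c m)) x.
  have [_ /(_ t' mt')] := Em; rewrite /refines sval_remainder// => nsub.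
  apply: contrapT => nx; apply: nsub => x xt'.
  by apply: contrapT => xm; apply: nx; exists x.
exists x; apply/remove_closuresP; split=> //.
move: xt' tm; rewrite !all_map /t' /lists_in /=.
elim: {Et t' Et' Et'1 mt' t'0} t => //= a t IHt + /andP[/set_mem[am|->] tm].
  by rewrite mem_set//= => /andP[-> /IHt->].
move=> xt; apply/andP; split; first by rewrite /= notin_setE.
apply: IHt => //.
by move: xt; case: ifP => //= _ /andP[].
Qed.

(** The removal lemma concerns an open set [V], whereas compactness gives a
point in its closure only; hence the shrinking of [U] to [V]. *)
Lemma avoid_evaded (U : nopen X) : exists (V : nopen X) (x : X),
  sval U x /\ forall a, evaded_at V a -> ~ sval (c a) x.
Proof.
have [V VU] := shrink_nopen U; exists V.
have cV : compact (closure (sval V)).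
  by apply: (subclosed_compact _ X_compact) => //; exact: closed_closure.
have [|s /remove_evaded_neq0[x /remove_closuresP[Vx xs]]|x Vx xV] :=
    @compact_avoid _ _ _ (evaded_at V) (fun a => sval (c a)) cV.
- by move=> a _; case: (svalP (c a)).
- exists x; first exact: subset_closure.
  move: xs; rewrite all_map; apply: sub_all => a /=; rewrite !notin_setE.
  by apply: contra_not; exact: subset_closure.
- by exists x; split=> //; exact: VU.
Qed.

End AvoidingPoints.

(** If no countable family is coinitial, the points avoiding the evaded indices
form a dense set. A countable dense subset of it would consist of points
attached to a sequence of open sets; this sequence evades some [a], and all
these points lie outside the nonempty open set [c a]. *)
Lemma countable_pi_base :
  (forall Y : set X, dense Y -> exists S, [/\ S `<=` Y, countable S & dense S]) ->
  exists2 B : set_system X, pi_base B & countable B.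
Proof.
move=> sepX.
have [p0|nop] := pselect (inhabited (nopen X)); last first.
  exists set0 => //; split=> // U oU U0; exfalso; apply: nop.
  by constructor; exists U.
case: p0 => p0.
have [/(_ id)[D DP]|nsmall] := pselect (small (@refines X) [set: nopen X]).
  exists (range (fun n => sval (D n))).
    by apply: coinitial_pi_base => U; exact: DP.
  exact: card_le_trans (card_image_le _ _) (card_lexx _).
have [lt [A [c [swo cP]]]] := evading_family p0 (@refines_refl X)
  (@refines_trans X) (@remainder_nil X) nsmall.
have /choice[V /choice[y yP]] := avoid_evaded A c swo.
have dY : dense (range y).
  move=> O O0 oO; have [yO _] := yP (exist _ O (conj oO O0)).
  by exists (y (exist _ O (conj oO O0))); split=> //; eexists.
have [S [SY /countable_injP[f finj] dS]] := sepX _ dY.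
have /choice[h hP] n : exists U, (exists U', S (y U') /\ f (y U') = n) ->
    S (y U) /\ f (y U) = n.
  have [[U SU]|no] := pselect (exists U', S (y U') /\ f (y U') = n).
    by exists U.
  by exists p0 => /no.
have [a Aa ha] := cP (V \o h).
have [ca_open ca_neq0] := svalP (c a).
have [x [cax Sx]] := dS _ ca_neq0 ca_open.
have [U _ yUx] := SY x Sx; rewrite -yUx in Sx cax.
have [SyU fyU] := hP (f (y U)) (ex_intro _ U (conj Sx erefl)).
have yUh : y (h (f (y U))) = y U by apply: finj; rewrite ?inE.
have [_ /(_ a)] := yP (h (f (y U))); rewrite yUh => nca.
by case: nca => //; split=> // s; exact: (ha (f (y U))).
Qed.

End CompactHausdorff.

(** * The pi-weight and the selection principle *)

(** A countable pi-base need not be of least cardinality: when a finite pi-base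
exists, the least one is found among the finite ones; otherwise any countable
pi-base is infinite, hence embeds in every other one. *)
Lemma pi_weight_le_nat (X : topologicalType) (B : set_system X) :
  pi_base B -> countable B -> pi_weight_le X [set: nat].
Proof.
move=> piB cB; pose card_pi n := `[< exists B' : set_system X, pi_base B' /\ (B' #= `I_n)%card >].
have [[n nP]|nofin] := pselect (exists n, card_pi n).
  have exn : exists n, card_pi n by exists n.
  case: (ex_minnP exn) => m /asboolP[B' [piB' B'm]] mmin; exists B'; split.
    split=> // C piC; rewrite (card_le_eql B'm).
    have [/finite_setP[k Ck]|/infiniteP] := pselect (finite_set C).
      rewrite (card_le_eqr Ck) card_le_II; apply: mmin.
      by apply/asboolP; exists C.
    by apply: card_le_trans; exact: finite_set_countable.
  by apply: finite_set_countable; exists m.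
exists B; split=> //; split=> // C piC; apply: card_le_trans cB _.
apply/infiniteP => /finite_setP[k Ck]; apply: nofin; exists k.
by apply/asboolP; exists C.
Qed.

Lemma ideal_initial_segment (I : set_system nat) n :
  set_ideal I -> admissible_set_ideal I -> I `I_n.
Proof.
move=> [I0 IU IS] adm; elim: n => [|n In]; first by rewrite II0.
by apply: IS (IU _ _ In (adm n)) => k /=; rewrite ltnS leq_eqVlt => /orP[/eqP|]; [right|left].
Qed.

(** An injection [f] of the pi-base into the natural numbers makes finite the
part of it used at stage [n], namely the members with [f V <= n]. An open set
that contains the member [V] is met at all stages from [f V] on. *)
Lemma countable_pi_base_H_separable (I : set_system nat) (X : topologicalType)
    (B : set_system X) :
  set_ideal I -> admissible_set_ideal I -> pi_base B -> countable B ->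
  H_separable I X.
Proof.
move=> idI admI [Bopen Bpi] /countable_injP[f finj] Y dY.
have [[x0 _]|noX] := pselect ([set: X] !=set0); last first.
  exists (fun=> set0); split=> [n|U _ [x _]]; first by split=> [|x].
  by exfalso; apply: noX; exists x.
pose g n V := xget x0 (V `&` Y n).
exists (fun n => g n @` [set V | [/\ B V, V !=set0 & f V <= n]]); split=> [n|U oU U0].
  split; last first.
    move=> _ [V [BV V0 _] <-]; rewrite /g.
    by case: xgetP => [x _ []//|noV]; have [x /noV] := dY n V V0 (Bopen V BV).
  apply: finite_image; apply: (@card_le_finite _ _ _ `I_n.+1) => //.
  have finj' : {in [set V | [/\ B V, V !=set0 & f V <= n]] &, injective f}.
    by move=> V W /set_mem[BV _ _] /set_mem[BW _ _]; apply: finj; exact/mem_set.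
  rewrite -(card_le_eql (inj_card_eq finj')).
  by apply: subset_card_le => _ [V [_ _ Vn] <-].
have [V [BV V0 VU]] := Bpi U oU U0; have [_ _ IS] := idI.
apply: IS (ideal_initial_segment (f V) idI admI) => n /= UFn.
rewrite ltnNge; apply/negP => fVn.
suff : (U `&` (g n @` [set V | [/\ B V, V !=set0 & f V <= n]])) (g n V).
  by rewrite UFn.
split; last by exists V.
rewrite /g; case: xgetP => [x _ [/VU]//|noV].
by have [x /noV] := dY n V V0 (Bopen V BV).
Qed.

(** Applied to a constant sequence, the selection principle gives finite sets
whose union is dense: an open set missing all of them would put the whole set of
natural numbers in the ideal. *)
Lemma H_separable_dense (I : set_system nat) (X : topologicalType) :
  set_ideal I -> proper_set_ideal I -> H_separable I X ->
  forall Y : set X, dense Y -> exists S, [/\ S `<=` Y, countable S & dense S].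
Proof.
move=> [_ _ IS] properI sepX Y dY; have [F [FY FI]] := sepX (fun=> Y) (fun=> dY).
exists (\bigcup_n F n); split.
- by move=> x [n _]; case: (FY n) => _; apply.
- apply: bigcup_countable => // n _; apply: finite_set_countable.
  by case: (FY n).
- move=> O O0 oO; apply: contrapT => noO; apply: properI.
  apply: IS (FI O oO O0) => n _ /=.
  apply/seteqP; split=> // x [Ox Fx]; apply: noO; exists x; split=> //.
  by exists n.
Qed.

Theorem proposition3p14 (I : set_system nat) (X : topologicalType)
  (I_ideal : set_ideal I) (I_proper : proper_set_ideal I) (I_adm : admissible_set_ideal I)
  (X_compact : compact [set: X]) (X_hausdorff : hausdorff_space X) :
  H_separable I X <-> pi_weight_le X [set: nat].
Proof.
split=> [sepX|[B [[piB _] cB]]].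
  have [B piB cB] := countable_pi_base X_compact X_hausdorff
    (H_separable_dense I_ideal I_proper sepX).
  exact: pi_weight_le_nat piB cB.
exact: countable_pi_base_H_separable piB cB.
Qed.
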